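(* Let $g(X)\in\mathbb{F}_q[X]$ and let $\mathfrak{Z}=\{\alpha\in\mathbb{F}_q : g(\alpha)=0\}$. Let $(\alpha,\beta)\in(\mathbb{F}_q\setminus\mathfrak{Z})\times\mathbb{F}_q$ and let $\mathcal{A}(X,Y)\in K_{\alpha,\beta}$. Define $\gamma=\beta/g(\alpha)$ and $\mathcal{B}(X,Y)=\mathcal{A}(X,Y g(X))$. Then $$\mu_{\alpha,\beta}\big(\mathcal{A}(X,Y)\big)=\mu_{\alpha,\gamma}\big(\mathcal{B}(X,Y)\big).$$
   Context: $\mathbb{F}_q$ is the finite field with $q$ elements. For $(\alpha,\beta)\in\mathbb{F}_q\times\mathbb{F}_q$, $K_{\alpha,\beta}$ denotes the ring of rational functions in $\mathbb{F}_q(X,Y)$ without a pole at $(\alpha,\beta)$ (i.e. expressible with a denominator that does not vanish at $(\alpha,\beta)$). Every $\mathcal{A}\in K_{\alpha,\beta}$ has a power-series expansion $\mathcal{A}(X,Y)=\sum_{i,j\ge 0}a_{i,j}(X-\alpha)^i(Y-\beta)^j$, and the multiplicity function is $\mu_{\alpha,\beta}(\mathcal{A})=\max\{m\in\mathbb{N} : a_{i,j}=0 \text{ for all } i+j<m\}$, with the convention $\mu_{\alpha,\beta}(0)=+\infty$. (The function $\mathcal{B}$ has no pole at $(\alpha,\gamma)$, so $\mu_{\alpha,\gamma}(\mathcal{B})$ is defined.) *)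

(* Defs.v *)
From HB Require Import structures.
From mathcomp Require Import all_boot all_order all_algebra.
From mathcomp Require Import generic_quotient boolp classical_sets.
From mathcomp Require Import constructive_ereal.

Set Implicit Arguments.
Unset Strict Implicit.
Unset Printing Implicit Defensive.

Import GRing.Theory.
Local Open Scope ring_scope.
Local Open Scope quotient_scope.

(* With the conventions of [polyXY], {poly {poly F}} is F[X, Y]: 'X is X,
   'Y = 'X%:P is Y, the coefficient of X^i Y^j in p is p`_i`_j, p.[x, y] is
   p(x, y), and g^:P is g(X) for g : {poly F}. *)

Notation ratfun F := {fraction {poly {poly F}}}.

Definition ratX (F : fieldType) : ratfun F := tofrac 'X.
Definition ratY (F : fieldType) : ratfun F := tofrac 'Y.

(* The value p(u, v) of p at a point (u, v) of an F-algebra, whose structure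
   map is iota. *)
Definition bieval (F : fieldType) (S : comNzRingType) (iota : {rmorphism F -> S})
    (u v : S) (p : {poly {poly F}}) : S :=
  (map_poly (map_poly iota) p).[u, v].

HB.instance Definition _ (F : fieldType) (S : comNzRingType)
    (iota : {rmorphism F -> S}) (u v : S) :=
  GRing.RMorphism.copy (bieval iota u v)
    (horner_eval v \o horner_eval u%:P \o map_poly (map_poly iota)).

Definition poly_const (F : fieldType) : {rmorphism F -> {poly {poly F}}} :=
  polyC \o polyC.

Definition ratfun_const (F : fieldType) : {rmorphism F -> ratfun F} :=
  @tofrac {poly {poly F}} \o @poly_const F.

(* A(U, V); meaningful when the denominator of A does not vanish at (U, V), and
   then independent of the fraction representing A: see [ratsubst_frac]. *)
Definition ratsubst (F : fieldType) (A U V : ratfun F) : ratfun F :=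
  let ev := bieval (ratfun_const F) U V in
  ev \n_(repr A) / ev \d_(repr A).

Definition zeros (F : finFieldType) (g : {poly F}) : {set F} :=
  [set a | g.[a] == 0].

Definition regular_at (F : fieldType) (alpha beta : F) : set (ratfun F) :=
  fun A => exists N D : {poly {poly F}},
    D.[alpha, beta] != 0 /\ A = tofrac N / tofrac D.

(* The family a stands for the series \sum_(i, j) a i j (X-alpha)^i (Y-beta)^j. *)
Definition pseries (F : fieldType) := nat -> nat -> F.

Definition psmul (F : fieldType) (a b : pseries F) : pseries F := fun i j =>
  \sum_(k < i.+1) \sum_(l < j.+1) a k l * b (i - k)%N (j - l)%N.

(* p(X + alpha, Y + beta), whose coefficients are those of p in powers of
   X - alpha and Y - beta. *)
Definition recenter (F : fieldType) (alpha beta : F) (p : {poly {poly F}}) :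
    {poly {poly F}} :=
  bieval (poly_const F) ('X + alpha%:P%:P) ('Y + beta%:P%:P) p.

Definition taylor (F : fieldType) (alpha beta : F) (p : {poly {poly F}}) :
    pseries F :=
  fun i j => (recenter alpha beta p)`_i`_j.

(* The series of N / D is the series a with D a = N. *)
Definition is_expansion (F : fieldType) (alpha beta : F) (A : ratfun F)
    (a : pseries F) : Prop :=
  exists N D : {poly {poly F}},
    [/\ D.[alpha, beta] != 0, A = tofrac N / tofrac D &
        psmul (taylor alpha beta D) a =2 taylor alpha beta N].

(* Exists and is unique for A regular at (alpha, beta): see [expansionP] and
   [is_expansion_inj]. *)
Definition expansion (F : fieldType) (alpha beta : F) (A : ratfun F) :
    pseries F :=
  xget (fun _ _ => 0) (is_expansion alpha beta A).

Definition is_max (E : set nat) (m : nat) : Prop := (E `&` ubound E)%classic m.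

Definition vanishing_orders (F : fieldType) (a : pseries F) : set nat :=
  fun m => forall i j : nat, (i + j < m)%N -> a i j = 0.

(* For A regular at (alpha, beta) and nonzero the maximum exists: see [multP]. *)
Definition mult (F : fieldType) (alpha beta : F) (A : ratfun F) : \bar nat :=
  if A == 0 then +oo%E
  else (xget 0%N (is_max (vanishing_orders (expansion alpha beta A))))%:E%E.

Lemma bieval_C (F : fieldType) (S : comNzRingType) (iota : {rmorphism F -> S})
  (u v : S) c : bieval iota u v c%:P%:P = iota c.
Proof. rewrite /bieval map_polyC /= map_polyC /=. by rewrite !hornerC. Qed.

Lemma bieval_X (F : fieldType) (S : comNzRingType) (iota : {rmorphism F -> S})
  (u v : S) : bieval iota u v 'X = u.
Proof. by rewrite /bieval map_polyX hornerX hornerC. Qed.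

Lemma bieval_Y (F : fieldType) (S : comNzRingType) (iota : {rmorphism F -> S})
  (u v : S) : bieval iota u v 'Y = v.
Proof. by rewrite /bieval map_polyC /= map_polyX hornerC hornerX. Qed.

Definition bievalE := (bieval_C, bieval_X, bieval_Y).

Lemma birmorph_ext (F : fieldType) (S : comNzRingType)
    (f1 f2 : {rmorphism {poly {poly F}} -> S}) :
  f1 'X = f2 'X -> f1 'Y = f2 'Y -> (forall c, f1 c%:P%:P = f2 c%:P%:P) ->
  f1 =1 f2.
Proof.
move=> eX eY eC; elim/poly_ind => [|p q IHp]; first by rewrite !rmorph0.
rewrite !rmorphD !rmorphM IHp eX; congr (_ + _).
elim/poly_ind: q => [|q c IHq]; first by rewrite !rmorph0.
by rewrite !polyCD !polyCM !rmorphD !rmorphM IHq eY eC.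
Qed.

Lemma frac_reprE (F : fieldType) (A : ratfun F) :
  A = tofrac \n_(repr A) / tofrac \d_(repr A).
Proof.
set r := repr A; have d0 := denom_ratioP r.
have dF : (tofrac \d_r : ratfun F) != 0 by rewrite tofrac_eq0.
apply: (mulIf dF); rewrite divfK //.
have -> : A = \pi_(ratfun F) r by rewrite /r reprK.
clear dF; unlock FracField.tofrac.
rewrite -[LHS]FracField.pi_mul; apply/eqmodP; rewrite /= FracField.equivfE.
by rewrite /FracField.mulf !numden_Ratio ?oner_neq0 ?mulr1 // mulrC.
Qed.

Lemma frac_cross (F : fieldType) (N D M E : {poly {poly F}}) :
  D != 0 -> E != 0 -> (tofrac N / tofrac D : ratfun F) = tofrac M / tofrac E ->
  N * E = M * D.
Proof.
move=> D0 E0 e; apply/eqP; rewrite -tofrac_eq 2!tofracM -eqr_div ?tofrac_eq0 //.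
exact/eqP.
Qed.

Fact rmorph_cross (R : comNzRingType) (K : fieldType) (f : {rmorphism R -> K})
    (n d m e : R) :
  n * e = m * d -> f d != 0 -> f e != 0 -> f n / f d = f m / f e.
Proof.
by move=> E d0 e0; apply/eqP; rewrite eqr_div // -!rmorphM E.
Qed.

Lemma ratsubst_frac (F : fieldType) (A U V : ratfun F) (N D : {poly {poly F}}) :
  let ev := bieval (ratfun_const F) U V in
  D != 0 -> A = tofrac N / tofrac D ->
  ev \d_(repr A) != 0 -> ev D != 0 -> ratsubst A U V = ev N / ev D.
Proof.
move=> ev D0 eA d0 eD0.
have E : \n_(repr A) * D = N * \d_(repr A).
  by apply: frac_cross; rewrite ?denom_ratioP // -eA -frac_reprE.
pose f : {rmorphism {poly {poly F}} -> ratfun F} := ev.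
have := @rmorph_cross _ _ f _ _ _ _ E.
move/(_ d0). 
move/(_ eD0). 
move=> H.
exact H.
Qed.

Lemma bieval_scaleY_neq0 (F : fieldType) (g : {poly F}) (p : {poly {poly F}}) :
  g != 0 -> p != 0 ->
  bieval (poly_const F) 'X ('Y * g^:P) p != 0.
Proof.
move=> g0 p0.
pose ev : {rmorphism {poly {poly F}} -> {poly {poly F}}} :=
  bieval (poly_const F) 'X ('Y * g^:P).
pose f1 : {rmorphism {poly {poly F}} -> {poly {poly F}}} := swapXY \o ev.
pose f2 : {rmorphism {poly {poly F}} -> {poly {poly F}}} :=
  comp_poly (g%:P * 'X) \o swapXY.
have E : f1 =1 f2.
  apply: birmorph_ext => [||c].
  - by rewrite /f1 /f2 /= bieval_X swapXY_X comp_polyC.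
  - rewrite /f1 /f2 /= bieval_Y rmorphM /= swapXY_Y swapXY_map_polyC.
    by rewrite comp_polyX mulrC.
  - by rewrite /f1 /f2 /= bieval_C /= !swapXY_polyC !map_polyC comp_polyC.
by rewrite -swapXY_eq0 [swapXY _]E comp_poly_eq0 ?swapXY_eq0 // size_Cmul // size_polyX.
Qed.

Lemma bieval_tofrac (F : fieldType) (u v p : {poly {poly F}}) :
  bieval (ratfun_const F) (tofrac u) (tofrac v) p =
  tofrac (bieval (poly_const F) u v p).
Proof.
apply: (birmorph_ext (f1 := bieval _ _ _)
     (f2 := @tofrac {poly {poly F}} \o bieval _ _ _)) => [||c] /=;
by rewrite !bievalE.
Qed.

Lemma ratsubst_scaleY (F : fieldType) (g : {poly F}) (A : ratfun F)
    (N D : {poly {poly F}}) :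
  let ev := bieval (poly_const F) 'X ('Y * g^:P) in
  g != 0 -> D != 0 -> A = tofrac N / tofrac D ->
  ratsubst A (ratX F) (ratY F * tofrac g^:P) = tofrac (ev N) / tofrac (ev D).
Proof.
move=> ev g0 D0 eA; rewrite /ratX /ratY -tofracM.
rewrite (@ratsubst_frac _ _ _ _ N D) // !bieval_tofrac ?tofrac_eq0 //;
  by rewrite bieval_scaleY_neq0 // denom_ratioP.
Qed.

Lemma regular_scaleY (F : fieldType) (g : {poly F}) (alpha beta : F)
    (A : ratfun F) :
  g.[alpha] != 0 -> regular_at alpha beta A ->
  regular_at alpha (beta / g.[alpha])
    (ratsubst A (ratX F) (ratY F * tofrac g^:P)).
Proof.
move=> ga [N [D [D0 eA]]].
have g0 : g != 0 by apply: contraNneq ga => ->; rewrite horner0.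
have Dn0 : D != 0 by apply: contraNneq D0 => ->; rewrite !horner0.
pose ev := bieval (poly_const F) 'X ('Y * g^:P).
exists (ev N), (ev D); split; last exact: ratsubst_scaleY.
suff -> : (ev D).[alpha, beta / g.[alpha]] = D.[alpha, beta] by [].
pose h x y := horner_eval y \o horner_eval (x%:P : {poly F}).
apply: (birmorph_ext (f1 := h alpha (beta / g.[alpha]) \o ev)
    (f2 := h alpha beta)) => [||c] /=; rewrite /h /= /horner_eval /ev ?bievalE //.
- by rewrite !hornerE.
- rewrite hornerM horner_map /= !hornerE divfK //.
- by rewrite /= !hornerE.
Qed.

Definition low (F : fieldType) n (p : {poly {poly F}}) :=
  forall i j, (i + j < n)%N -> p`_i`_j = 0.

Lemma bicoefM (F : fieldType) (p q : {poly {poly F}}) i j :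
  (p * q)`_i`_j =
  \sum_(k < i.+1) \sum_(l < j.+1) p`_k`_l * q`_(i - k)`_(j - l).
Proof.
rewrite coefM coef_sum; apply: eq_bigr => k _; exact: coefM.
Qed.

Lemma lowM (F : fieldType) n m (p q : {poly {poly F}}) :
  low n p -> low m q -> low (n + m) (p * q).
Proof.
move=> lp lq i j lij; rewrite bicoefM big1 // => k _; rewrite big1 // => l _.
have [kl|kl] := ltnP (k + l) n; first by rewrite lp ?mul0r.
have lki := ltn_ord k; have llj := ltn_ord l.
rewrite lq ?mulr0 //; rewrite -(ltn_add2l n) (leq_ltn_trans _ lij) //.
rewrite (leq_trans (leq_add kl (leqnn _))) //.
by rewrite addnACA !subnKC.
Qed.

Lemma low0 (F : fieldType) (p : {poly {poly F}}) : low 0 p.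
Proof. by []. Qed.

Lemma lowD (F : fieldType) n (p q : {poly {poly F}}) :
  low n p -> low n q -> low n (p + q).
Proof. by move=> lp lq i j h; rewrite !coefD lp ?lq ?addr0. Qed.

Lemma lowMl (F : fieldType) n (p q : {poly {poly F}}) :
  low n q -> low n (p * q).
Proof. by move=> lq; apply: (lowM (low0 p) lq). Qed.

Lemma recenter00 (F : fieldType) (alpha beta : F) p :
  (recenter alpha beta p)`_0`_0 = p.[alpha, beta].
Proof.
rewrite -!horner_coef0 -[p in RHS]/(id p).
pose h (x y : F) := horner_eval y \o horner_eval (x%:P : {poly F}).
have := @birmorph_ext F F (h 0 0 \o bieval (poly_const F) ('X + alpha%:P%:P)
   ('Y + beta%:P%:P)) (h alpha beta) _ _ _ p.
rewrite /h /= /horner_eval polyC0; apply=> [||c]; rewrite /= ?bievalE /=.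
- by rewrite !hornerE.
- by rewrite !hornerE.
- by rewrite !hornerE.
Qed.

Lemma recenter_eq0 (F : fieldType) (alpha beta : F) p :
  (recenter alpha beta p == 0) = (p == 0).
Proof.
apply/eqP/eqP => [|->]; last by rewrite /recenter rmorph0.
move=> E; have : recenter (- alpha) (- beta) (recenter alpha beta p) = p.
  pose r a b : {rmorphism {poly {poly F}} -> {poly {poly F}}} :=
    bieval (poly_const F) ('X + a%:P%:P) ('Y + b%:P%:P).
  pose f1 : {rmorphism {poly {poly F}} -> {poly {poly F}}} :=
    r (- alpha) (- beta) \o r alpha beta.
  pose f2 : {rmorphism {poly {poly F}} -> {poly {poly F}}} := idfun.
  apply: (@birmorph_ext F _ f1 f2) => [||c]; rewrite /f1 /f2 /r /=.
  - rewrite bieval_X rmorphD /= bieval_X bieval_C /= !polyCN addrNK //.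
  - rewrite bieval_Y rmorphD /= bieval_Y bieval_C /= !polyCN addrNK //.
  - by rewrite !bieval_C.
by rewrite E /recenter rmorph0.
Qed.

Definition trunc (F : fieldType) n (a : pseries F) : {poly {poly F}} :=
  \poly_(i < n) \poly_(j < n) a i j.

Lemma coef_trunc (F : fieldType) n (a : pseries F) i j :
  (i + j < n)%N -> (trunc n a)`_i`_j = a i j.
Proof.
by move=> h; rewrite !coef_poly !(leq_ltn_trans _ h) ?leq_addl ?leq_addr
  // coef_poly (leq_ltn_trans _ h) ?leq_addl.
Qed.

Lemma psmul_trunc (F : fieldType) n (a : pseries F) (p q : {poly {poly F}}) :
  psmul (fun i j => p`_i`_j) a =2 (fun i j => q`_i`_j) ->
  low n (p * trunc n a - q).
Proof.
move=> E i j h; rewrite !coefB -E bicoefM; apply/eqP; rewrite subr_eq0; apply/eqP.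
apply: eq_bigr => k _; apply: eq_bigr => l _; rewrite coef_trunc //.
by rewrite (leq_ltn_trans _ h) // leq_add // leq_subr.
Qed.

Lemma low_cancel (F : fieldType) n (p q : {poly {poly F}}) :
  p`_0`_0 != 0 -> low n (p * q) -> low n q.
Proof.
move=> p0 lpq; elim: n lpq => // n IH lpq.
have lq : low n q by apply: IH => i j h; apply: lpq; rewrite ltnS ltnW.
move=> i j; rewrite ltnS leq_eqVlt => /orP[/eqP ijn|]; last exact: lq.
have := lpq i j; rewrite ijn ltnSn => /(_ isT).
rewrite bicoefM big_ord_recl big_ord_recl !subn0 big1 ?addr0 => [|l _].
  rewrite big1 ?addr0 => [/eqP|k _].
    by rewrite mulf_eq0 (negPf p0) => /eqP.
  rewrite big1 // => l _; rewrite lq ?mulr0 // -ijn.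
  by rewrite lift0 -addSn leq_add ?leq_subr // ltn_subrL (leq_ltn_trans _ (ltn_ord k)).
rewrite lq ?mulr0 // -ijn -addnS leq_add // lift0.
by rewrite ltn_subrL (leq_ltn_trans _ (ltn_ord l)).
Qed.

Lemma is_expansion_inj (F : fieldType) (alpha beta : F) (A : ratfun F)
    (a b : pseries F) :
  is_expansion alpha beta A a -> is_expansion alpha beta A b -> a = b.
Proof.
move=> [N [D [D0 eA Ea]]] [M [E [E0 eA' Eb]]].
apply/funext => i; apply/funext => j; set n := (i + j).+1.
have la := psmul_trunc (n := n) Ea; have lb := psmul_trunc (n := n) Eb.
have NE : N * E = M * D.
  have Dn0 : D != 0 by apply: contraNneq D0 => ->; rewrite !horner0.
  have En0 : E != 0 by apply: contraNneq E0 => ->; rewrite !horner0.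
  by apply: frac_cross => //; rewrite -eA.
pose r := recenter alpha beta.
have rM p q : r (p * q) = r p * r q by exact: rmorphM.
have : low n (r (D * E) * (trunc n a - trunc n b)).
  have -> : r (D * E) * (trunc n a - trunc n b) =
     r E * (r D * trunc n a - r N) + - r D * (r E * trunc n b - r M).
    have /(congr1 r) := NE; rewrite !rM => NE'.
    rewrite !mulrBr !mulNr opprK [r E * r N]mulrC NE' [r M * r D]mulrC.
    by rewrite addrACA [- _ + r D * r M]addrC subrr addr0 !mulrA [r E * r D]mulrC.
  by apply: lowD; apply: lowMl.
move/low_cancel; rewrite recenter00 !hornerM mulf_neq0 // => /(_ isT i j).
rewrite !coefB !coef_trunc ?ltnSn // => /(_ isT) /eqP.
by rewrite subr_eq0 => /eqP.
Qed.

Lemma expansionP (F : fieldType) (alpha beta : F) (A : ratfun F) :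
  regular_at alpha beta A -> is_expansion alpha beta A (expansion alpha beta A).
Proof.
move=> [N [D [D0 eA]]]; apply: xgetPex.
pose p := recenter alpha beta D; pose q := recenter alpha beta N.
pose d := p`_0`_0.
have d0 : d != 0 by rewrite /d recenter00.
pose e := 1 - d^-1%:P%:P * p.
have le : low 1 e.
  case=> [|i] [|j] //= _; rewrite /e !coefB !coefCM !coef1 /=.
  by rewrite -/d mulVf // ?coef1 ?mulr1n /= ?subrr.
have leX n : low n (e ^+ n).
  by elim: n => [|n IH] //; rewrite exprS; exact: (lowM le IH).
pose s n := \sum_(k < n) e ^+ k * (d^-1%:P%:P * q).
have sE n : p * s n = q - e ^+ n * q.
  have -> : p * s n = (1 - e) * (\sum_(k < n) e ^+ k) * q.
    have -> : 1 - e = d^-1%:P%:P * p by rewrite /e subKr.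
    by rewrite /s -mulr_suml mulrCA [p * _]mulrCA -!mulrA mulrCA; congr (_ * _); rewrite mulrCA.
  by rewrite -opprB mulNr -subrX1 opprB mulrBl mul1r.
have sS n m i j : (i + j < n)%N -> (n <= m)%N -> (s m)`_i`_j = (s n)`_i`_j.
  move=> h; elim: m => [|m IH]; first by rewrite leqn0 => /eqP->.
  rewrite leq_eqVlt => /orP[/eqP->//|]; rewrite ltnS => nm.
  rewrite /s big_ord_recr /= -/(s m) !coefD IH //.
  rewrite mulrC (lowMl _ (leX m)) ?addr0 //; exact: leq_trans nm.
exists (fun i j => (s (i + j).+1)`_i`_j); exists N, D; split=> // i j.
rewrite /taylor -/p -/q.
have -> : q`_i`_j = (p * s (i + j).+1)`_i`_j.
  by rewrite sE !coefB mulrC (lowMl _ (leX (i + j).+1)) ?subr0.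
rewrite bicoefM; apply: eq_bigr => k _; apply: eq_bigr => l _.
by congr (_ * _); rewrite [RHS](sS ((i - k) + (j - l)).+1) ?ltnS ?leq_add ?leq_subr.
Qed.

Lemma multP (F : fieldType) (alpha beta : F) (A : ratfun F) :
  regular_at alpha beta A -> A != 0 ->
  exists2 m, mult alpha beta A = m%:E%E &
    is_max (vanishing_orders (expansion alpha beta A)) m.
Proof.
move=> /expansionP; set a := expansion _ _ _ => -[N [D [D0 eA Ea]]] A0.
rewrite /mult (negPf A0) -/a; eexists; first by [].
apply: xgetPex.
have [i [j aij]] : exists i j, a i j <> 0.
  apply: contrapT => /forallNP a0; move/eqP: A0; apply.
  suff N0 : N = 0 by rewrite eA N0 tofrac0 mul0r.
  apply/eqP; rewrite -(recenter_eq0 alpha beta); apply/eqP.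
  apply/polyP => i; apply/polyP => j; rewrite !coef0 -[LHS]Ea.
  rewrite /psmul big1 // => k _; rewrite big1 // => l _.
  by have /forallNP/(_ (j - l)%N)/contrapT -> := a0 (i - k)%N; rewrite mulr0.
pose P m := `[< vanishing_orders a m >].
have bP m : P m -> (m <= i + j)%N.
  by move=> /asboolP Pm; rewrite leqNgt; apply/negP => /Pm.
have exP : exists m, P m by exists 0%N; apply/asboolP.
case: (ex_maxnP exP bP) => m /asboolP Pm max; exists m; split=> // n /asboolP.
exact: max.
Qed.

(* Main.v *)
(** The order of vanishing of N / D at a point P is that of N, that is, the
    largest m such that the recentered polynomial N(P + (X, Y)) has no term of
    degree below m.  A polynomial substitution sending Q to P cannot decrease
    this order.  This applies to Y |-> Y g(X), which sends (alpha, gamma) to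
    (alpha, beta), and to Y |-> Y h(X), where h is an inverse of g modulo
    (X - alpha)^m: the composite is the identity up to terms of order m at
    (alpha, beta), so orders below m are preserved exactly. *)
Require Import Defs.
From HB Require Import structures.
From mathcomp Require Import all_boot all_order all_algebra.
From mathcomp Require Import boolp classical_sets constructive_ereal.

Import GRing.Theory.
Local Open Scope ring_scope.

HB.instance Definition _ (F : fieldType) (alpha beta : F) :=
  GRing.RMorphism.copy (recenter alpha beta)
    (bieval (poly_const F) ('X + alpha%:P%:P) ('Y + beta%:P%:P)).

(** * Polynomials without terms of degree below n, and their images under substitutions *)

Section Low.
Variable F : fieldType.
Implicit Types (p q : {poly {poly F}}) (f : {rmorphism {poly {poly F}} -> {poly {poly F}}}).

Lemma low_zero n : low n (0 : {poly {poly F}}).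
Proof. by move=> i j _; rewrite !coef0. Qed.

Lemma lowN n p : low n p -> low n (- p).
Proof. by move=> lp i j h; rewrite !coefN lp ?oppr0. Qed.

Lemma low_sum n (I : Type) (r : seq I) (P : pred I) (G : I -> {poly {poly F}}) :
  (forall i, P i -> low n (G i)) -> low n (\sum_(i <- r | P i) G i).
Proof.
move=> lG; elim/big_ind: _ => //; first exact: low_zero.
by move=> p q; apply: lowD.
Qed.

Lemma low_exp n p k : low n p -> low (n * k) (p ^+ k).
Proof.
move=> lp; elim: k => [|k IH]; first by rewrite muln0; apply: low0.
by rewrite mulnS exprS; apply: lowM.
Qed.

Lemma low_leq n m p : (m <= n)%N -> low n p -> low m p.
Proof. by move=> mn lp i j h; apply: lp; apply: leq_trans mn. Qed.

Lemma low1P p : low 1 p <-> p`_0`_0 = 0.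
Proof.
split=> [lp|p0 i j]; first exact: lp.
by rewrite ltnS leqn0 addn_eq0 => /andP[/eqP-> /eqP->].
Qed.

Lemma bipolyE p :
  p = \sum_(i < size p) \sum_(j < size p`_i) (p`_i`_j)%:P%:P * 'Y ^+ j * 'X ^+ i.
Proof.
rewrite -[LHS]coefK poly_def; apply: eq_bigr => i _.
rewrite -mulr_suml -mul_polyC; congr (_ * _).
rewrite -[X in X%:P = _]coefK poly_def rmorph_sum; apply: eq_bigr => j _.
by rewrite -mul_polyC rmorphM rmorphXn.
Qed.

(** Such an [f] turns a monomial X^i Y^j into a product of i + j factors without constant term, so a
    term of degree at least m goes to a polynomial of order at least m. *)
Lemma low_rmorph f m p :
  (forall c, f c%:P%:P = c%:P%:P) -> low 1 (f 'X) -> low 1 (f 'Y) ->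
  low m p -> low m (f p).
Proof.
move=> fC fX fY lp; rewrite [p]bipolyE rmorph_sum; apply: low_sum => i _.
rewrite rmorph_sum; apply: low_sum => j _.
rewrite !rmorphM !rmorphXn fC -mulrA.
have [ijm|mij] := ltnP (i + j) m.
  by rewrite lp // !polyC0 mul0r; apply: low_zero.
apply: (low_leq (j + i)); first by rewrite addnC.
by apply: lowMl; apply: lowM; rewrite -[X in low X]mul1n; apply: low_exp.
Qed.

(** The polynomials of order at least n form an ideal, so two substitutions congruent modulo it on
    constants, X and Y are congruent everywhere. *)
Lemma low_rmorphB f1 f2 n :
  (forall c, f1 c%:P%:P = f2 c%:P%:P) -> low n (f1 'X - f2 'X) ->
  low n (f1 'Y - f2 'Y) -> forall p, low n (f1 p - f2 p).
Proof.
move=> eC eX eY.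
(* One Horner step, used with z = X in the outer induction and with z = Y in the inner one. *)
have lMD p q z : low n (f1 p - f2 p) -> low n (f1 z - f2 z) ->
    low n (f1 q - f2 q) -> low n (f1 (p * z + q) - f2 (p * z + q)).
  move=> lp lz lq; rewrite !rmorphD !rmorphM opprD addrACA; apply: lowD => //.
  have -> : f1 p * f1 z - f2 p * f2 z =
      f1 p * (f1 z - f2 z) + f2 z * (f1 p - f2 p).
    by rewrite !mulrBr [f1 p * f2 z]mulrC addrA subrK [f2 z * f2 p]mulrC.
  by apply: lowD; apply: lowMl.
elim/poly_ind => [|p q IHp]; first by rewrite !rmorph0 subrr; apply: low_zero.
apply: (lMD) => //; elim/poly_ind: q => [|q c IHq].
  by rewrite !rmorph0 subrr; apply: low_zero.
by rewrite polyCD polyCM; apply: lMD => //; rewrite eC subrr; apply: low_zero.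
Qed.

End Low.

(** * Orders at an arbitrary point, for polynomials and for fractions *)

Section Recenter.
Variable F : fieldType.
Implicit Types (p q N D : {poly {poly F}}) (a b c d : F).

Lemma recenterK a b : cancel (recenter a b) (recenter (- a) (- b)).
Proof.
apply: (@birmorph_ext F _ (recenter (- a) (- b) \o recenter a b) idfun) => [||c];
  rewrite /= /recenter bievalE ?rmorphD /= !bievalE //= !polyCN addrNK //.
Qed.

Lemma low1_recenter a b p : low 1 (recenter a b p) <-> p.[a, b] = 0.
Proof. by rewrite low1P recenter00. Qed.

(** Conjugating [f] by the translations to (a, b) and (c, d) gives a substitution that fixes the
    origin, to which [low_rmorph] applies. *)
Lemma low_recenter_rmorph (f : {rmorphism {poly {poly F}} -> {poly {poly F}}})
    a b c d m p :
  (forall e, f e%:P%:P = e%:P%:P) -> (f 'X).[c, d] = a -> (f 'Y).[c, d] = b ->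
  low m (recenter a b p) -> low m (recenter c d (f p)).
Proof.
move=> fC fX fY; rewrite -[p in f p](recenterK a b).
apply: (low_rmorph F (recenter c d \o f \o recenter (- a) (- b))) => /=.
- by move=> e; rewrite /= {2}/recenter bievalE fC /recenter bievalE.
- apply/low1_recenter; rewrite /recenter bievalE rmorphD /= fC.
  by rewrite !hornerE fX subrr.
- apply/low1_recenter; rewrite /recenter bievalE rmorphD /= fC.
  by rewrite !hornerE fY subrr.
Qed.

(** A factor with nonzero constant term does not change the order. The expansion comes with its own
    fraction N' / D', which cross-multiplication compares with N / D; truncating the series at m
    keeps the argument among polynomials. *)
Lemma vanishing_orders_expansion a b (A : ratfun F) N D m :
  D.[a, b] != 0 -> A = tofrac N / tofrac D ->
  vanishing_orders (expansion a b A) m <-> low m (recenter a b N).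
Proof.
move=> D0 eA.
have [|N' [D' [D'0 eA' E]]] := @expansionP F a b A; first by exists N, D.
have {}E := @psmul_trunc F m _ _ _ E.
have lowE : low m (trunc m (expansion a b A)) <-> low m (recenter a b N').
  split=> [lt|lN'].
    have -> : recenter a b N' = recenter a b D' * trunc m (expansion a b A)
        - (recenter a b D' * trunc m (expansion a b A) - recenter a b N').
      by rewrite subKr.
    by apply: lowD; [apply: lowMl | apply: lowN].
  apply: (@low_cancel F m (recenter a b D')); first by rewrite recenter00.
  by rewrite -[_ * _](subrK (recenter a b N')); apply: lowD.
have NN' : recenter a b D' * recenter a b N = recenter a b D * recenter a b N'.
  rewrite -!rmorphM mulrC [D * _]mulrC; congr recenter.
  apply: (@frac_cross F N D N' D'); rewrite -?eA //.
    by apply: contraNneq D0 => ->; rewrite !horner0.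
  by apply: contraNneq D'0 => ->; rewrite !horner0.
have -> : vanishing_orders (expansion a b A) m <->
    low m (trunc m (expansion a b A)).
  by split=> v i j h; have := v i j h; rewrite coef_trunc.
rewrite lowE; split=> l.
  by apply: (@low_cancel F m (recenter a b D')); rewrite ?recenter00 // NN'; apply: lowMl.
by apply: (@low_cancel F m (recenter a b D)); rewrite ?recenter00 // -NN'; apply: lowMl.
Qed.

Lemma eq_mult a b c d (A B : ratfun F) :
  (A == 0) = (B == 0) ->
  (forall m, vanishing_orders (expansion a b A) m <->
             vanishing_orders (expansion c d B) m) ->
  mult a b A = mult c d B.
Proof.
move=> AB0 eqV; rewrite /mult AB0.
(* [f_equal] rather than a rewrite: ssreflect's matching would unfold both
   expansions trying to convert one into the other. *)
exact: (f_equal (fun V => if B == 0 then +oo%E else (xget 0%N (is_max V))%:E%E)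
  (funext (fun m => propext (eqV m)))).
Qed.

End Recenter.

(** * The substitution Y |-> Y g(X) and its inverse up to high order *)

Section ScaleY.
Variable F : fieldType.
Implicit Types (g h : {poly F}) (p : {poly {poly F}}) (a b : F).

Definition scaleY g : {rmorphism {poly {poly F}} -> {poly {poly F}}} :=
  bieval (poly_const F) 'X ('Y * g^:P).

Lemma scaleY_Y g : scaleY g 'Y = 'Y * g^:P.
Proof. exact: bieval_Y. Qed.

Lemma scaleY_polyXY g h : scaleY g h^:P = h^:P.
Proof.
elim/poly_ind: h => [|h c IH]; first by rewrite !rmorph0.
rewrite !rmorphD !rmorphM IH /=; congr (_ * _ + _).
  by rewrite map_polyX bievalE.
by rewrite map_polyC bievalE.
Qed.

(** The division-free relation between b and d allows the use both for g and, in the opposite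
    direction, for its inverse h. *)
Lemma low_scaleY g a b d m p :
  d * g.[a] = b ->
  low m (recenter a b p) -> low m (recenter a d (scaleY g p)).
Proof.
move=> gb; apply: low_recenter_rmorph => [e||]; rewrite /= bievalE //.
  by rewrite !hornerE.
by rewrite hornerM horner_map !hornerE.
Qed.

Lemma low_recenter_polyXY h a b m :
  ('X - a%:P) ^+ m %| h -> low m (recenter a b h^:P).
Proof.
move=> /divpK <-; rewrite !rmorphM !rmorphXn /=; apply: lowMl.
rewrite -[X in low X]mul1n; apply: low_exp; apply/low1_recenter.
by rewrite horner_map !hornerE subrr.
Qed.

(** As g does not vanish at a, it is coprime to (X - a)^m; h is its Bezout coefficient. *)
Lemma inverse_mod_exp g a m : g.[a] != 0 ->
  exists h, ('X - a%:P) ^+ m %| h * g - 1.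
Proof.
move=> ga; have: coprimep g (('X - a%:P) ^+ m).
  by apply: coprimep_expr; rewrite coprimep_XsubC.
move=> /Bezout_eq1_coprimepP[[u v] /= uv].
by exists u; rewrite -uv opprD addNKr dvdpNr dvdp_mull.
Qed.

Lemma low_scaleYE g a b m p : g.[a] != 0 ->
  low m (recenter a (b / g.[a]) (scaleY g p)) <-> low m (recenter a b p).
Proof.
move=> ga; split; last by apply: low_scaleY; rewrite divfK.
(* For m = 0 the modulus is 1 and would not force h(a) g(a) = 1. *)
case: m => [|m]; first by move=> _; apply: low0.
have [h hP] := @inverse_mod_exp g a m.+1 ga.
have hga : h.[a] * g.[a] = 1.
  apply/eqP; rewrite -subr_eq0 -hornerM -[1](hornerC 1 a) -hornerN -hornerD.
  by rewrite -rootE root_factor_theorem (dvdp_trans _ hP) // exprS dvdp_mulr.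
have bh : b * h.[a] = b / g.[a].
  by apply: (mulIf ga); rewrite divfK // -mulrA hga mulr1.
move=> /(low_scaleY h _ _ _ _ _ bh) l.
(* With S the image of p under both substitutions, p = S - (S - p): [l] bounds the order of S, and
   the composite being the identity modulo order m bounds that of S - p. *)
rewrite -[recenter a b p](subKr (recenter a b (scaleY h (scaleY g p)))).
apply: lowD l _; apply: lowN.
apply: (low_rmorphB F (recenter a b \o scaleY h \o scaleY g) (recenter a b))
  => [c||] /=.
- by rewrite /scaleY /= !bievalE.
- by rewrite /scaleY /= !bievalE subrr; apply: low_zero.
(* On Y the difference is Y (h g - 1), a multiple of (X - a)^m. *)
rewrite scaleY_Y rmorphM scaleY_Y scaleY_polyXY -mulrA.
have -> : h^:P * g^:P = (h * g - 1)^:P + 1 by rewrite rmorphB rmorphM rmorph1 subrK.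
rewrite mulrDr mulr1 rmorphD addrK rmorphM; apply: lowMl.
exact: low_recenter_polyXY.
Qed.

End ScaleY.

Theorem theorem1 (F : finFieldType) (g : {poly F}) (alpha beta : F)
    (A : ratfun F) :
  alpha \notin zeros g ->
  regular_at alpha beta A ->
  let gamma := beta / g.[alpha] in
  let B := ratsubst A (ratX F) (ratY F * tofrac g^:P) in
  mult alpha beta A = mult alpha gamma B.
Proof.
rewrite inE => ga [N [D [D0 eA]]] gamma B.
have g0 : g != 0 by apply: contraNneq ga => ->; rewrite horner0.
have Dn0 : D != 0 by apply: contraNneq D0 => ->; rewrite !horner0.
pose ev := scaleY F g.
have eB : B = tofrac (ev N) / tofrac (ev D) by apply: ratsubst_scaleY.
have evD0 : (ev D).[alpha, gamma] != 0.
  (* Vanishing at a point means order at least 1, so this is the case m = 1 of the invariance. *)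
  apply: contraNneq D0 => /low1_recenter /(low_scaleYE F g alpha beta 1 D ga).
  by move=> /low1_recenter ->.
(* Injectivity puts A and B on the same side of the convention that 0 has infinite multiplicity. *)
have ev_eq0 (p : {poly {poly F}}) : (ev p == 0) = (p == 0).
  apply/idP/idP => [|/eqP->]; last by rewrite /ev rmorph0.
  by apply: contraLR; apply: bieval_scaleY_neq0.
have AB0 : (A == 0) = (B == 0).
  by rewrite eA eB !mulf_eq0 !invr_eq0 !tofrac_eq0 !ev_eq0.
apply: eq_mult AB0 _ => m.
have vA := vanishing_orders_expansion F _ _ _ _ _ m D0 eA.
have vB := vanishing_orders_expansion F _ _ _ _ _ m evD0 eB.
apply: (iff_trans vA); apply: (iff_trans _ (iff_sym vB)).
exact: (iff_sym (low_scaleYE F g alpha beta m N ga)).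
Qed.
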